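(* Let $R$ be a $2$-torsion free $\sigma$-prime ring, where $\sigma$ is an involution of $R$, and let $U$ be a square closed $\sigma$-Lie ideal of $R$. If $d$ is a derivation of $R$ satisfying $[d(u),u]\in Z(R)$ for all $u\in U$, then $U\subseteq Z(R)$ or $d=0$.
   Context: $R$ is an associative ring (not assumed to have an identity) with center $Z(R)$, and $[x,y]=xy-yx$. An involution $\sigma$ of $R$ is an additive map $\sigma:R\to R$ with $\sigma(xy)=\sigma(y)\sigma(x)$ and $\sigma(\sigma(x))=x$ for all $x,y\in R$. $R$ is $2$-torsion free if $2x=0$ with $x\in R$ implies $x=0$. $R$ is $\sigma$-prime if, for all $a,b\in R$, $aRb=aR\sigma(b)=0$ implies $a=0$ or $b=0$. A derivation of $R$ is an additive map $d:R\to R$ with $d(xy)=d(x)y+xd(y)$ for all $x,y\in R$. A Lie ideal of $R$ is an additive subgroup $U$ of $R$ such that $[u,r]\in U$ for all $u\in U$, $r\in R$; it is a $\sigma$-Lie ideal if moreover $\sigma(U)\subseteq U$, and it is square closed if moreover $u^2\in U$ for all $u\in U$. *)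

(* Defs.v *)
(* MathComp, with sets from the classical layer of MathComp-Analysis. *)
From HB Require Import structures.
From mathcomp Require Import all_boot all_algebra.
From mathcomp Require Import boolp classical_sets.

Set Implicit Arguments.
Unset Strict Implicit.
Unset Printing Implicit Defensive.

Import GRing.Theory.

Local Open Scope classical_set_scope.
Local Open Scope ring_scope.

(* The product of the semigroup structure; [x * y] would require a unit. *)
Notation "x ** y" := (monoid.mul x y)
  (at level 40, left associativity) : ring_scope.

(* Associative rings, not assumed unital, unlike MathComp's ring structures. *)
HB.mixin Record Zmodule_Semigroup_isRng R of GRing.Zmodule R & Semigroup R := {
  rng_mulDl : forall x y z : R, (x + y) ** z = x ** z + y ** z;
  rng_mulDr : forall x y z : R, x ** (y + z) = x ** y + x ** z
}.

#[short(type="rngType")]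
HB.structure Definition Rng :=
  { R of Zmodule_Semigroup_isRng R & GRing.Zmodule R & Semigroup R }.

Definition lie (R : rngType) (x y : R) : R := x ** y - y ** x.

Definition rng_center (R : rngType) : set R :=
  [set z | forall x : R, commute z x].
Arguments rng_center R : clear implicits.

Definition two_torsion_free (R : rngType) : Prop :=
  forall x : R, x *+ 2 = 0 -> x = 0.

Definition involution (R : rngType) (sigma : {additive R -> R}) : Prop :=
  (forall x y : R, sigma (x ** y) = sigma y ** sigma x) /\ involutive sigma.

Definition sigma_prime (R : rngType) (sigma : R -> R) : Prop :=
  forall a b : R,
    (forall r : R, a ** r ** b = 0) -> (forall r : R, a ** r ** sigma b = 0) ->
    a = 0 \/ b = 0.

Definition derivation (R : rngType) (d : {additive R -> R}) : Prop :=
  forall x y : R, d (x ** y) = d x ** y + x ** d y.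

Definition additive_subgroup (R : rngType) (U : set R) : Prop :=
  U 0 /\ forall u v : R, U u -> U v -> U (u - v).

Definition lie_ideal (R : rngType) (U : set R) : Prop :=
  additive_subgroup U /\ forall u r : R, U u -> U (lie u r).

Definition sigma_lie_ideal (R : rngType) (sigma : R -> R) (U : set R) : Prop :=
  lie_ideal U /\ sigma @` U `<=` U.

Definition square_closed (R : rngType) (U : set R) : Prop :=
  forall u : R, U u -> U (u ** u).

(* Main.v *)
Require Import Defs.
From HB Require Import structures.
From mathcomp Require Import all_boot all_algebra.
From mathcomp Require Import boolp classical_sets.

Set Implicit Arguments.
Unset Strict Implicit.
Unset Printing Implicit Defensive.

Import GRing.Theory.

Local Open Scope classical_set_scope.
Local Open Scope ring_scope.

(** The argument reduces the statement to elements that [sigma] fixes or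
    negates, where [sigma]-primeness behaves like ordinary primeness, although
    [d] need not commute with [sigma].

    A [sigma]-prime ring is semiprime, so a square closed Lie ideal [U] that is
    not central contains a nonzero commutator [[u, v]]
    ([commuting_lie_ideal_central]).  Being closed under [2uv], such a [U] even
    contains the doubled ideal [2 R [U, U] R] ([commutator_mull_mulr]), and
    [R [U, U]] has zero right annihilator ([commutators_faithful]).  Hence a
    derivation that vanishes on [U] is zero ([derivation_vanishing]); for inner
    derivations, this says that the centralizer of [U] is [Z(R)].

    Polarizing at [u] and [u^2], both in [U], the condition [[d u, u]] central
    sharpens to [[d u, u] = 0] ([centralizing_commuting]).  Polarizing again at
    [u] and [2vu] gives [[v, u] d u = 0], then [[w, u] U d u = 0], and therefore
    [[w, u] R ([x, y] R d u) = 0] for all [w], [x], [y] in [U].  When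
    [sigma u = u] or [sigma u = -u], the set of all [[w, u]] is stable under
    [sigma], so [sigma]-primeness makes [u] central or [d u] zero
    ([central_or_killed]).

    A group is not the union of two proper subgroups, so this alternative is
    uniform on the symmetric elements of [U], and likewise on the skew ones.
    Mixed outcomes still force [d] to vanish on both
    ([central_skew_killed], [central_sym_killed]).  Since [2u] is the sum of a
    symmetric and a skew element, [U] is central or [d] vanishes on [U]. *)

(** * Arithmetic without a unit *)

Section RngTheory.
Context (R : rngType).
Implicit Types x y z : R.

Lemma rng_mul0l x : 0 ** x = 0.
Proof. by apply: (addrI (0 ** x)); rewrite -rng_mulDl !addr0. Qed.

Lemma rng_mul0r x : x ** 0 = 0.
Proof. by apply: (addrI (x ** 0)); rewrite -rng_mulDr !addr0. Qed.

Lemma rng_mulNl x y : (- x) ** y = - (x ** y).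
Proof. by apply: (addrI (x ** y)); rewrite -rng_mulDl !subrr rng_mul0l. Qed.

Lemma rng_mulNr x y : x ** (- y) = - (x ** y).
Proof. by apply: (addrI (x ** y)); rewrite -rng_mulDr !subrr rng_mul0r. Qed.

Lemma rng_mulrn2l x y : (x *+ 2) ** y = (x ** y) *+ 2.
Proof. by rewrite !mulr2n rng_mulDl. Qed.

Lemma rng_mulrn2r x y : x ** (y *+ 2) = (x ** y) *+ 2.
Proof. by rewrite !mulr2n rng_mulDr. Qed.

Lemma lie_xx x : lie x x = 0.
Proof. exact: subrr. Qed.

Lemma lie_antisym x y : - lie x y = lie y x.
Proof. exact: opprB. Qed.

Lemma lieBr x : zmod_morphism (lie x).
Proof.
move=> y z; rewrite /lie rng_mulDr rng_mulDl rng_mulNr rng_mulNl.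
by rewrite !opprD !opprK addrACA.
Qed.

(* Inner derivations become additive maps, the type required of derivations. *)
HB.instance Definition _ x := GRing.isZmodMorphism.Build R R (lie x) (lieBr x).

Lemma lieDl x y z : lie (x + y) z = lie x z + lie y z.
Proof. by rewrite /lie rng_mulDr rng_mulDl opprD addrACA. Qed.

Lemma lieDr x y z : lie x (y + z) = lie x y + lie x z.
Proof. exact: raddfD. Qed.

Lemma lie_mulrn2l x y : lie (x *+ 2) y = lie x y *+ 2.
Proof. by rewrite !mulr2n lieDl. Qed.

Lemma lie_mulr x y z : lie x (y ** z) = lie x y ** z + y ** lie x z.
Proof.
rewrite /lie rng_mulDl rng_mulDr rng_mulNl rng_mulNr.
by rewrite !mulgA addrA subrK.
Qed.

Lemma lie_derivation x : derivation (lie x).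
Proof. exact: lie_mulr. Qed.

Lemma lie_mull x y z : lie (x ** y) z = lie x z ** y + x ** lie y z.
Proof.
by rewrite -lie_antisym lie_mulr opprD -rng_mulNl -rng_mulNr !lie_antisym.
Qed.

Lemma rng_centerP z : rng_center R z <-> forall x, lie z x = 0.
Proof.
split=> [cz x|cz x]; first by rewrite /lie cz subrr.
by apply/eqP; rewrite -subr_eq0; apply/eqP/cz.
Qed.

Lemma rng_centerB x y : rng_center R x -> rng_center R y -> rng_center R (x - y).
Proof.
move=> cx cy z.
by rewrite /commute rng_mulDl rng_mulDr rng_mulNl rng_mulNr cx cy.
Qed.

End RngTheory.

Section AdditiveSubgroups.
Context (R : rngType) (U : set R).
Hypothesis subU : additive_subgroup U.

Lemma additive_subgroupN u : U u -> U (- u).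
Proof. by move=> Uu; rewrite -sub0r; apply: subU.2 => //; apply: subU.1. Qed.

Lemma additive_subgroupD u v : U u -> U v -> U (u + v).
Proof.
by move=> Uu Uv; rewrite -[v]opprK; apply: subU.2 => //; apply: additive_subgroupN.
Qed.

End AdditiveSubgroups.

Lemma subgroup_sub_union (R : rngType) (U A B : set R) :
  additive_subgroup U -> additive_subgroup A -> additive_subgroup B ->
  (forall u, U u -> A u \/ B u) -> U `<=` A \/ U `<=` B.
Proof.
move=> subU sA sB UAB; apply: contrapT => /not_orP[].
move=> /existsNP[a /not_implyP[Ua nAa]] /existsNP[b /not_implyP[Ub nBb]].
have Ba : B a by case: (UAB a Ua).
have Ab : A b by case: (UAB b Ub).
case: (UAB (b - a)); first exact: subU.2.
  by move=> Aba; apply: nAa; rewrite -[a](subKr b); apply: sA.2.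
by move=> Bba; apply: nBb; rewrite -[b](subrK a); apply: additive_subgroupD.
Qed.

Lemma rng_center_subgroup (R : rngType) : additive_subgroup (rng_center R).
Proof.
split; last exact: rng_centerB.
by move=> x; rewrite /commute rng_mul0l rng_mul0r.
Qed.

Lemma kernel_subgroup (R : rngType) (d : {additive R -> R}) :
  additive_subgroup [set x | d x = 0].
Proof.
by split=> [|x y /= dx dy]; rewrite /= ?raddf0 // raddfB dx dy subrr.
Qed.

(** * Sigma-primeness *)

Section SigmaPrime.
Context (R : rngType) (sigma : {additive R -> R}).
Hypotheses (inv_sigma : involution sigma) (prime_sigma : sigma_prime sigma).

(** If [a R a = 0], then for [b = a r sigma a] both [a R b] and [a R sigma b]
    vanish, which reduces to the case [a R sigma a = 0]. *)
Lemma sigma_prime_semiprime (a : R) : (forall r, a ** r ** a = 0) -> a = 0.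
Proof.
have [sigmaM sigmaK] := inv_sigma; move=> aRa.
have aRsa r : a ** r ** sigma a = 0.
  have [||->|//] := @prime_sigma a (a ** r ** sigma a).
  - by move=> s; rewrite !mulgA aRa !rng_mul0l.
  - by move=> s; rewrite !sigmaM sigmaK !mulgA aRa !rng_mul0l.
  - by rewrite !rng_mul0l.
by case: (@prime_sigma a a).
Qed.

(** [b R a] consists of elements with [c R c = 0]. *)
Lemma annihilator_sym (a b : R) :
  (forall r, a ** r ** b = 0) -> forall r, b ** r ** a = 0.
Proof.
move=> aRb r; apply: sigma_prime_semiprime => s.
have -> : b ** r ** a ** s ** (b ** r ** a) = b ** r ** (a ** s ** b) ** r ** a.
  by rewrite !mulgA.
by rewrite aRb rng_mul0r !rng_mul0l.
Qed.

(** [sigma_prime] puts [sigma] on the right factor only; the symmetry of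
    annihilation in a semiprime ring moves it to the left. *)
Lemma sigma_prime_left (a b : R) :
    (forall r, a ** r ** b = 0) -> (forall r, sigma a ** r ** b = 0) ->
  a = 0 \/ b = 0.
Proof.
move=> /annihilator_sym bRa /annihilator_sym bRsa.
by case: (@prime_sigma b a); [| | right | left].
Qed.

Lemma central_sq0 (z : R) : rng_center R z -> z ** z = 0 -> z = 0.
Proof.
move=> cz zz; apply: sigma_prime_semiprime => r.
by rewrite -mulgA -(cz r) mulgA zz rng_mul0l.
Qed.

Hypothesis tf : two_torsion_free R.

(** An argument of Herstein.  Here [ad u] squares to zero, so the Leibniz rule
    for its square gives [2 [u, y] [u, z] = 0]; taking [z = r y] then yields
    [[u, y] R [u, y] = 0]. *)
Lemma commuting_lie_ideal_central (U : set R) :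
    lie_ideal U -> (forall u v, U u -> U v -> lie u v = 0) ->
  U `<=` rng_center R.
Proof.
move=> [_ lieU] comU u Uu; apply/rng_centerP => x.
have ad2 y : lie u (lie u y) = 0 by apply: comU => //; apply: lieU.
have ad11 y z : lie u y ** lie u z = 0.
  apply: tf; have := ad2 (y ** z).
  rewrite lie_mulr lieDr !lie_mulr !ad2.
  by rewrite rng_mul0l rng_mul0r add0r addr0 mulr2n.
apply: sigma_prime_semiprime => r.
have := ad11 x (r ** x).
by rewrite lie_mulr rng_mulDr !mulgA ad11 rng_mul0l add0r.
Qed.

End SigmaPrime.

(** * Square closed Lie ideals *)

Section SquareClosed.
Context (R : rngType) (U : set R).
Hypotheses (lieU : lie_ideal U) (sqU : square_closed U).
Let subU := lieU.1.

(** [uv + vu = (u + v)^2 - u^2 - v^2] and [uv - vu = [u, v]] are both in [U]. *)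
Lemma square_closed_mul2 u v : U u -> U v -> U ((u ** v) *+ 2).
Proof.
move=> Uu Uv.
have -> : (u ** v) *+ 2 = (u + v) ** (u + v) - u ** u - v ** v + lie u v.
  have -> : (u + v) ** (u + v) = u ** v + v ** u + (u ** u + v ** v).
    by rewrite rng_mulDl !rng_mulDr [u ** u + u ** v]addrC addrACA.
  by rewrite -[_ - u ** u - _]addrA -opprD addrK /lie addrACA subrr addr0.
apply: additive_subgroupD => //; last exact: lieU.2.
apply: subU.2; last exact: sqU.
apply: subU.2; last exact: sqU.
by apply: sqU; apply: additive_subgroupD.
Qed.

(** By the Leibniz rule [[u, v] r = [u, v r] - v [u, r]], and [[u, r]] is in
    [U]. *)
Lemma commutator_mulr u v r : U u -> U v -> U ((lie u v ** r) *+ 2).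
Proof.
move=> Uu Uv.
have -> : (lie u v ** r) *+ 2 = lie u (v ** r) *+ 2 - (v ** lie u r) *+ 2.
  by rewrite lie_mulr mulrnDl addrK.
apply: subU.2; last by apply: square_closed_mul2 => //; apply: lieU.2.
by rewrite mulr2n; apply: additive_subgroupD => //; apply: lieU.2.
Qed.

(** This is what turns a Lie ideal into something as large as a two-sided
    ideal: bracketing [2 [u, v] r] with [s] differs from [-2 s [u, v] r] by
    another element [2 [u, v] r s] of [U]. *)
Lemma commutator_mull_mulr u v r s : U u -> U v -> U ((s ** lie u v ** r) *+ 2).
Proof.
move=> Uu Uv.
have -> : (s ** lie u v ** r) *+ 2 =
  (lie u v ** (r ** s)) *+ 2 - lie ((lie u v ** r) *+ 2) s.
  by rewrite {3}/lie rng_mulrn2l rng_mulrn2r !mulgA subKr.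
by apply: subU.2; [exact: commutator_mulr|apply: lieU.2; exact: commutator_mulr].
Qed.

End SquareClosed.

(** * Derivations and non-central square closed sigma-Lie ideals *)

Section NonCentral.
Context (R : rngType) (sigma : {additive R -> R}) (U : set R).
Hypotheses (tf : two_torsion_free R) (inv_sigma : involution sigma).
Hypotheses (prime_sigma : sigma_prime sigma) (slieU : sigma_lie_ideal sigma U).
Hypotheses (sqU : square_closed U) (ncU : ~ U `<=` rng_center R).

Let lieU := slieU.1.
Let subU := lieU.1.

Lemma sigma_lie_ideal_stable u : U u -> U (sigma u).
Proof. by move=> Uu; apply: slieU.2; exists u. Qed.

Lemma sigma_lie x y : sigma (lie x y) = lie (sigma y) (sigma x).
Proof. by rewrite /lie raddfB !inv_sigma.1. Qed.

(** [U] is [sigma]-stable, so the hypothesis passes from a nonzero commutator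
    [c] to [sigma c], and primeness applies to the pair [c], [q]. *)
Lemma commutators_faithful q :
  (forall u v s, U u -> U v -> lie u v ** s ** q = 0) -> q = 0.
Proof.
move=> annq; apply: contrapT => q0; apply: ncU.
apply: (commuting_lie_ideal_central inv_sigma prime_sigma tf lieU) => u v Uu Uv.
case: (sigma_prime_left inv_sigma prime_sigma (a := lie u v) (b := q)) => //.
- by move=> r; apply: annq.
- by move=> r; rewrite sigma_lie; apply: annq; apply: sigma_lie_ideal_stable.
Qed.

(** [d] kills both [2 c s] and [2 c s x] for every commutator [c] of [U], hence
    [c s (d x) = 0]. *)
Lemma derivation_vanishing (d : {additive R -> R}) :
  derivation d -> (forall u, U u -> d u = 0) -> forall x, d x = 0.
Proof.
move=> der dU x; apply: commutators_faithful => u v s Uu Uv.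
have d0 r : d (lie u v ** r) = 0.
  by apply: tf; rewrite -raddfMn; apply: dU; apply: commutator_mulr.
by have := d0 (s ** x); rewrite mulgA der d0 rng_mul0l add0r.
Qed.

Lemma centralizer_central u : (forall w, U w -> lie u w = 0) -> rng_center R u.
Proof.
move=> cu; apply/rng_centerP => x.
exact: (derivation_vanishing (@lie_derivation R u)).
Qed.

Context (d : {additive R -> R}).
Hypotheses (der : derivation d).

(** Let [z = [d u, u]].  The polarized hypothesis at [u] and [u^2] says that
    [4 z u], hence [z u], is central.  Bracketing [z u] with [d u] gives [z^2 = 0], and a
    semiprime ring has no central element of square zero but [0]. *)
Lemma centralizing_commuting :
    (forall u, U u -> rng_center R (lie (d u) u)) ->
  forall u, U u -> lie (d u) u = 0.
Proof.
move=> cd u Uu; set z := lie (d u) u; have cz : rng_center R z by exact: cd.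
have Uuu := sqU Uu.
have cross : lie (d u) (u ** u) + lie (d (u ** u)) u = (z ** u) *+ 2 *+ 2.
  rewrite der lie_mulr lieDl !lie_mull lie_xx -/z.
  by rewrite rng_mul0l rng_mul0r addr0 add0r -(cz u) -mulr2n.
have czu : rng_center R ((z ** u) *+ 2 *+ 2).
  rewrite -cross.
  have -> : lie (d u) (u ** u) + lie (d (u ** u)) u =
      lie (d (u + u ** u)) (u + u ** u) - z - lie (d (u ** u)) (u ** u).
    rewrite (raddfD d) lieDl !lieDr -/z.
    by rewrite -[_ - z - _]addrA -opprD [z + _]addrC [X in X - _]addrACA addrK.
  apply: rng_centerB; last exact: cd.
  by apply: rng_centerB => //; apply/cd/(additive_subgroupD subU).
apply: (central_sq0 inv_sigma prime_sigma) => //.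
have lie_zu r : lie (z ** u) r = 0.
  by apply: tf; apply: tf; rewrite -!lie_mulrn2l; apply: (rng_centerP _).1.
have := lie_zu (d u); rewrite lie_mull (rng_centerP z).1 //.
rewrite rng_mul0l add0r -lie_antisym -/z rng_mulNr => /eqP.
by rewrite oppr_eq0 => /eqP.
Qed.

Hypothesis comd : forall u, U u -> lie (d u) u = 0.

Lemma commuting_linearized u v :
  U u -> U v -> lie (d u) v + lie (d v) u = 0.
Proof.
move=> Uu Uv; have := comd (additive_subgroupD subU Uu Uv).
by rewrite (raddfD d) lieDl !lieDr !comd // add0r addr0.
Qed.

(** The polarized identity at [u] and [2vu] is, up to the factor [2], the one at
    [u] and [v] multiplied by [u], plus [[v, u] d u]. *)
Lemma commuting_annihilates u v : U u -> U v -> lie v u ** d u = 0.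
Proof.
move=> Uu Uv; apply: tf.
have := commuting_linearized Uu (square_closed_mul2 lieU sqU Uv Uu).
rewrite !raddfMn /= lie_mulrn2l -mulrnDl.
rewrite der lieDl !lie_mull lie_mulr (comd Uu) lie_xx !rng_mul0r !addr0.
by rewrite addrA -rng_mulDl commuting_linearized // rng_mul0l add0r.
Qed.

(** Inserting an element of [U] in the middle is what makes primeness
    applicable, since [U] contains [2 R [U, U] R]. *)
Lemma commuting_annihilates_mid u v w :
  U u -> U v -> U w -> lie w u ** v ** d u = 0.
Proof.
move=> Uu Uv Uw; apply: tf.
have := commuting_annihilates Uu (square_closed_mul2 lieU sqU Uw Uv).
rewrite lie_mulrn2l lie_mull rng_mulrn2l rng_mulDl.
by rewrite -[w ** _ ** _]mulgA commuting_annihilates // rng_mul0r addr0.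
Qed.

(** For [v = 2 r [x, y] s] the previous identity reads
    [[w, u] r ([x, y] s (d u)) = 0].  The condition on [sigma u] turns
    [sigma [w, u]] into [[sigma w, u]] up to sign, so the same holds with
    [sigma [w, u]] in place of [[w, u]]. *)
Lemma central_or_killed u :
  U u -> sigma u = u \/ sigma u = - u -> rng_center R u \/ d u = 0.
Proof.
move=> Uu su; case: (EM (d u = 0)); [by right|move=> du; left].
apply: centralizer_central => w Uw; apply: contrapT => luw.
apply: du; apply: commutators_faithful => x y s Ux Uy.
have ann v r : U v -> lie v u ** r ** (lie x y ** s ** d u) = 0.
  move=> Uv; apply: tf.
  have := commuting_annihilates_mid Uu (commutator_mull_mulr lieU sqU s r Ux Uy) Uv.
  by rewrite rng_mulrn2r rng_mulrn2l !mulgA.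
case: (sigma_prime_left inv_sigma prime_sigma (a := lie w u)
        (b := lie x y ** s ** d u)) => [r|r|luw0|//].
- exact: ann.
- have Usw := sigma_lie_ideal_stable Uw.
  rewrite sigma_lie -lie_antisym; case: su => ->.
    by rewrite !rng_mulNl ann // oppr0.
  by rewrite raddfN /= opprK; apply: ann.
- by case: luw; rewrite -lie_antisym luw0 oppr0.
Qed.

(** * Symmetric and skew elements *)

Let sym : set R := [set u | U u /\ sigma u = u].
Let skew : set R := [set u | U u /\ sigma u = - u].

Lemma sym_subgroup : additive_subgroup sym.
Proof.
split=> [|u v [Uu su] [Uv sv]]; first by split; [exact: subU.1|exact: raddf0].
by split; [exact: subU.2|rewrite raddfB su sv].
Qed.

Lemma skew_subgroup : additive_subgroup skew.
Proof.
split=> [|u v [Uu su] [Uv sv]].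
  by split; [exact: subU.1|rewrite oppr0; exact: raddf0].
by split; [exact: subU.2|rewrite raddfB su sv opprD].
Qed.

Lemma sym_part u : U u -> sym (u + sigma u).
Proof.
move=> Uu; split; last by rewrite raddfD /= inv_sigma.2 addrC.
by apply: (additive_subgroupD subU) => //; apply: sigma_lie_ideal_stable.
Qed.

Lemma skew_part u : U u -> skew (u - sigma u).
Proof.
move=> Uu; split; last by rewrite raddfB /= inv_sigma.2 opprB.
by apply: subU.2 => //; apply: sigma_lie_ideal_stable.
Qed.

Lemma sym_skew_split u : u *+ 2 = (u + sigma u) + (u - sigma u).
Proof. by rewrite addrACA subrr addr0 mulr2n. Qed.

Lemma derivation_center z : rng_center R z -> rng_center R (d z).
Proof.
move=> /rng_centerP cz; apply/rng_centerP => x.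
have -> : lie (d z) x = d (lie z x) - lie z (d x).
  rewrite /lie raddfB !der opprD [- (d x ** z) + _]addrC [d z ** x + _ + _]addrACA.
  by rewrite addrK.
by rewrite !cz raddf0 subrr.
Qed.

(** [k^2] is symmetric, so [2 k (d k) = d (k^2) = 0], and then
    [k R (d k) = sigma k R (d k) = 0] because [k] is central. *)
Lemma central_skew_killed :
  (forall s, sym s -> d s = 0) -> forall k, skew k -> rng_center R k -> d k = 0.
Proof.
move=> dsym k [Uk sk] ck.
have kdk : k ** d k = 0.
  apply: tf; have : d (k ** k) = 0.
    apply: dsym; split; first exact: sqU.
    by rewrite inv_sigma.1 sk rng_mulNl rng_mulNr opprK.
  by rewrite der -(ck (d k)) mulr2n.
have kRdk r : k ** r ** d k = 0 by rewrite (ck r) -mulgA kdk rng_mul0r.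
case: (sigma_prime_left inv_sigma prime_sigma (a := k) (b := d k)) => // [r|->].
  by rewrite sk !rng_mulNl kRdk oppr0.
exact: raddf0.
Qed.

(** For [s] symmetric, hence central, and [k] skew, [2 s k] is skew, so
    [(d s) k = 0]; as [d s] is central, primeness gives [d s = 0] or [k = 0].
    Were all skew [k] zero, [U] would consist of symmetric, hence central,
    elements. *)
Lemma central_sym_killed :
    (forall k, skew k -> d k = 0) -> (forall s, sym s -> rng_center R s) ->
  forall s, sym s -> d s = 0.
Proof.
move=> dskew csym s ss; apply: contrapT => ds; apply: ncU => u Uu.
suff su : sigma u = u by apply: csym.
apply/esym/eqP; rewrite -subr_eq0; apply/eqP.
have [Uk sk] := skew_part Uu; set k := u - sigma u in Uk sk *.
have cds := derivation_center (csym s ss).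
have dsk : d s ** k = 0.
  have : d ((s ** k) *+ 2) = 0.
    apply: dskew; split; first by apply: square_closed_mul2 => //; apply: ss.1.
    by rewrite raddfMn /= inv_sigma.1 sk ss.2 rng_mulNl -(csym s ss k) mulNrn.
  by rewrite raddfMn => /tf; rewrite der [d k]dskew ?rng_mul0r ?addr0 //; split.
have dsRk r : d s ** r ** k = 0 by rewrite (cds r) -mulgA dsk rng_mul0r.
by case: (@prime_sigma (d s) k) => // r; rewrite sk rng_mulNr dsRk oppr0.
Qed.

(** If both the symmetric and the skew elements of [U] were central, so would be
    [2u] for every [u] in [U]; in the other three cases [d] vanishes on [U]. *)
Lemma commuting_zero x : d x = 0.
Proof.
have dichot (V : set R) : V `<=` U -> additive_subgroup V ->
    (forall v, V v -> sigma v = v \/ sigma v = - v) ->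
    V `<=` rng_center R \/ V `<=` [set v | d v = 0].
  move=> VU subV sV; apply: (subgroup_sub_union subV).
  - exact: rng_center_subgroup.
  - exact: kernel_subgroup.
  - by move=> v Vv; apply: central_or_killed; [exact: VU|exact: sV].
have symD := dichot sym (fun _ => @proj1 _ _) sym_subgroup
  (fun _ p => or_introl p.2).
have skewD := dichot skew (fun _ => @proj1 _ _) skew_subgroup
  (fun _ p => or_intror p.2).
suff [dsym dskew] : (forall s, sym s -> d s = 0) /\ (forall k, skew k -> d k = 0).
  apply: (derivation_vanishing der) => u Uu; apply: tf.
  rewrite -raddfMn sym_skew_split raddfD /=.
  by rewrite dsym ?dskew ?addr0 //; [exact: skew_part|exact: sym_part].
case: symD => hsym; case: skewD => hskew.
- case: ncU => u Uu; apply/rng_centerP => y; apply: tf.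
  rewrite -lie_mulrn2l sym_skew_split lieDl.
  rewrite (rng_centerP _).1; last exact/hsym/sym_part.
  by rewrite (rng_centerP _).1 ?addr0 //; exact/hskew/skew_part.
- by split=> //; apply: central_sym_killed.
- by split=> // k kk; apply: central_skew_killed => //; apply: hskew.
- by split.
Qed.

End NonCentral.

Theorem theorem1 (R : rngType) (sigma : {additive R -> R}) (U : set R)
    (d : {additive R -> R}) :
  two_torsion_free R ->
  involution sigma ->
  sigma_prime sigma ->
  sigma_lie_ideal sigma U ->
  square_closed U ->
  derivation d ->
  (forall u : R, U u -> rng_center R (lie (d u) u)) ->
  U `<=` rng_center R \/ (forall x : R, d x = 0).
Proof.
move=> tf inv_sigma prime_sigma slieU sqU der cend.
have [|ncU] := EM (U `<=` rng_center R); [by left|right].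
apply: (commuting_zero tf inv_sigma prime_sigma slieU sqU ncU der).
exact: (centralizing_commuting tf inv_sigma prime_sigma slieU sqU der cend).
Qed.
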